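(* For every $w\in\mathbb N$, the set $\mathcal{AS}_w$ is a set of generators of the $K$-vector space $\mathcal{AL}_w$. In particular, $$\dim_K\mathcal{AL}_w\le s(w).$$
   Context: Let $\mathbb F_q$ be a finite field with $q$ elements, $K=\mathbb F_q(\theta)$, $K_\infty=\mathbb F_q((1/\theta))$, $\mathbb N=\{1,2,\dots\}$. Put $\ell_0=1$ and $\ell_d=\prod_{i=1}^d(\theta-\theta^{q^i})$ for $d\ge1$. For $\mathfrak s=(s_1,\dots,s_n)\in\mathbb N^n$ and $\varepsilon=(\varepsilon_1,\dots,\varepsilon_n)\in(\mathbb F_q^\times)^n$ the alternating Carlitz multiple polylogarithm (ACMPL) is $$\mathrm{Li}\begin{pmatrix}\varepsilon\\ \mathfrak s\end{pmatrix}=\sum_{d_1>\dots>d_n\ge0}\frac{\varepsilon_1^{d_1}\cdots\varepsilon_n^{d_n}}{\ell_{d_1}^{s_1}\cdots\ell_{d_n}^{s_n}}\in K_\infty,$$ of weight $s_1+\dots+s_n$. $\mathcal{AL}_w$ is the $K$-vector subspace of $K_\infty$ spanned by all ACMPL's of weight $w$. $\mathcal{AS}_w$ is the set of ACMPL's $\mathrm{Li}\begin{pmatrix}\varepsilon\\ \mathfrak s\end{pmatrix}$ of weight $w$ with $q\nmid s_i$ for all $i$ (and $\varepsilon\in(\mathbb F_q^\times)^n$ arbitrary). The integers $s(w)$ are defined by $s(w)=(q-1)q^{w-1}$ for $1\le w<q$, $s(q)=(q-1)(q^{q-1}-1)$, and $s(w)=(q-1)\sum_{i=1}^{q-1}s(w-i)+s(w-q)$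 for $w>q$. *)

(* Defs.v *)
From HB Require Import structures.
From mathcomp Require Import all_boot all_algebra fraction.
From mathcomp Require Import all_classical topology.

Set Implicit Arguments.
Unset Strict Implicit.
Unset Printing Implicit Defensive.

Import GRing.Theory.
Local Open Scope quotient_scope.
Local Open Scope classical_set_scope.
Local Open Scope ring_scope.

Lemma frac_reprE (R : idomainType) (x : {fraction R}) :
  x = FracField.tofrac \n_(repr x) / FracField.tofrac \d_(repr x).
Proof.
have d0 : FracField.tofrac \d_(repr x) != 0 by rewrite tofrac_eq0 denom_ratioP.
apply: (mulIf d0); rewrite divfK // -{1}[x]reprK; unlock FracField.tofrac.
rewrite -[LHS]FracField.pi_mul; apply/eqmodP => /=.
by rewrite FracField.equivfE /FracField.mulf /= !numden_Ratio
  ?mulf_neq0 ?oner_neq0 ?denom_ratioP // !mulr1 mulrC.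
Qed.

Lemma fracP (R : idomainType) (x : {fraction R}) :
  exists a b, b != 0 /\ x = FracField.tofrac a / FracField.tofrac b.
Proof.
by exists \n_(repr x), \d_(repr x); split; [exact: denom_ratioP|exact: frac_reprE].
Qed.

(* A record rather than an alias of [nat -> R], so that the pointwise ring     *)
(* structure on functions does not interfere with the Cauchy product.         *)
Record fps (R : Type) := Fps { fpsc : nat -> R }.

Section FpsRing.
Variable F : fieldType.
Implicit Types f g h : fps F.

HB.instance Definition _ := gen_eqMixin (fps F).
HB.instance Definition _ := gen_choiceMixin (fps F).

Lemma fpsP f g : (forall n, fpsc f n = fpsc g n) -> f = g.
Proof. by case: f g => [f] [g] /= fg; congr Fps; apply/funext. Qed.

Definition fps0 : fps F := Fps (fun=> 0).
Definition fps_add f g : fps F := Fps (fun n => fpsc f n + fpsc g n).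
Definition fps_opp f : fps F := Fps (fun n => - fpsc f n).

Lemma fps_addA : associative fps_add.
Proof. by move=> f g h; apply: fpsP => n /=; rewrite addrA. Qed.
Lemma fps_addC : commutative fps_add.
Proof. by move=> f g; apply: fpsP => n /=; rewrite addrC. Qed.
Lemma fps_add0 : left_id fps0 fps_add.
Proof. by move=> f; apply: fpsP => n /=; rewrite add0r. Qed.
Lemma fps_addN : left_inverse fps0 fps_opp fps_add.
Proof. by move=> f; apply: fpsP => n /=; rewrite addNr. Qed.

HB.instance Definition _ :=
  GRing.isZmodule.Build (fps F) fps_addA fps_addC fps_add0 fps_addN.

Definition fps_const (c : F) : fps F := Fps (fun n => if n == 0%N then c else 0).
Definition fps_mul f g : fps F :=
  Fps (fun n => \sum_(i < n.+1) fpsc f i * fpsc g (n - i)).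

Definition fps_trunc n f : {poly F} := \poly_(i < n.+1) fpsc f i.

Lemma fps_mul_trunc f g n k : (k <= n)%N ->
  fpsc (fps_mul f g) k = (fps_trunc n f * fps_trunc n g)`_k.
Proof.
move=> kn; rewrite coefM /=; apply: eq_bigr => i _.
have ik : (i <= k)%N by rewrite -ltnS.
rewrite !coef_poly !ltnS (leq_trans ik kn).
by rewrite (leq_trans (leq_subr i k) kn).
Qed.

Lemma fps_mulC : commutative fps_mul.
Proof.
by move=> f g; apply: fpsP => n; rewrite !(@fps_mul_trunc _ _ n n) // mulrC.
Qed.

Lemma fps_mulA : associative fps_mul.
Proof.
move=> f g h; apply: fpsP => n.
transitivity ((fps_trunc n f * fps_trunc n g * fps_trunc n h)`_n); last first.
  rewrite coefM; apply: eq_bigr => i _.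
  have iN : (i <= n)%N by rewrite -ltnS.
  by rewrite -(fps_mul_trunc _ _ iN) coef_poly ltnS leq_subr.
rewrite -mulrA coefM; apply: eq_bigr => i _.
have iN : (i <= n)%N by rewrite -ltnS.
by rewrite -(fps_mul_trunc _ _ (leq_subr i n)) coef_poly ltnS iN.
Qed.

Lemma fps_mul1 : left_id (fps_const 1) fps_mul.
Proof.
move=> f; apply: fpsP => n /=; rewrite big_ord_recl /= subn0 mul1r big1 ?addr0 //.
by move=> i _; rewrite mul0r.
Qed.

Lemma fps_mulDl : left_distributive fps_mul fps_add.
Proof.
move=> f g h; apply: fpsP => n /=; rewrite -big_split /=.
by apply: eq_bigr => i _; rewrite mulrDl.
Qed.

Lemma fps_1neq0 : fps_const 1 != 0.
Proof. by apply/eqP => /(congr1 (@fpsc F))/(congr1 (@^~ 0%N))/eqP; rewrite oner_eq0. Qed.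

HB.instance Definition _ := GRing.Zmodule_isComNzRing.Build (fps F)
  fps_mulA fps_mulC fps_mul1 fps_mulDl fps_1neq0.

Definition fps_unit : {pred fps F} := fun f => `[< exists g, g * f = 1 >].
Definition fps_inv f : fps F :=
  if pselect (exists g, g * f = 1) is left ex then projT1 (cid ex) else f.

Lemma fps_mulVf : {in fps_unit, left_inverse 1 fps_inv *%R}.
Proof.
move=> f /asboolP uf; rewrite /fps_inv; case: pselect => // ex.
exact: (projT2 (cid ex)).
Qed.
Lemma fps_unitP f g : g * f = 1 -> f \in fps_unit.
Proof. by move=> gf; apply/asboolP; exists g. Qed.
Lemma fps_inv_out : {in [predC fps_unit], fps_inv =1 id}.
Proof.
move=> f /negP nf; rewrite /fps_inv; case: pselect => // ex.
by case: nf; apply/asboolP.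
Qed.

HB.instance Definition _ := GRing.ComNzRing_hasMulInverse.Build (fps F)
  fps_mulVf fps_unitP fps_inv_out.

Lemma fpsc_sum (I : Type) (r : seq I) (P : pred I) (G : I -> fps F) n :
  fpsc (\sum_(i <- r | P i) G i) n = \sum_(i <- r | P i) fpsc (G i) n.
Proof. by elim/big_rec2: _ => // i y x _ <-. Qed.

Lemma fps_neq0 f : f != 0 -> exists n, fpsc f n != 0.
Proof.
move=> /eqP f0; apply: contrapT => h; apply: f0; apply: fpsP => n /=.
by apply: contrapT => /eqP fn; apply: h; exists n.
Qed.

Lemma fps_mulf_eq0 f g : f * g = 0 -> (f == 0) || (g == 0).
Proof.
move=> fg; rewrite -[_ || _]negbK negb_or; apply/negP => /andP[f0 g0].
have [m fm mmin] := ex_minnP (fps_neq0 f0).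
have [n gn nmin] := ex_minnP (fps_neq0 g0).
have := congr1 ((@fpsc F)^~ (m + n)%N) fg => /=.
have mlt : (m < (m + n).+1)%N by rewrite ltnS leq_addr.
rewrite (bigD1 (Ordinal mlt)) //= addKn big1 ?addr0 => [/eqP|i].
  by rewrite mulf_eq0 (negbTE fm) (negbTE gn).
rewrite -val_eqE /= => im.
have [ltim|lemi] := ltnP i m.
  suff /eqP -> : fpsc f i == 0 by rewrite mul0r.
  by apply: contraTT ltim => /mmin; rewrite -leqNgt.
have ltmi : (m < i)%N by rewrite ltn_neqAle eq_sym im.
suff /eqP -> : fpsc g (m + n - i) == 0 by rewrite mulr0.
apply: contraTT ltmi => /nmin h; rewrite -leqNgt.
have ile : (i <= m + n)%N by rewrite -ltnS.
by rewrite -(leq_add2r n) -{2}(subnKC ile) leq_add2l.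
Qed.

HB.instance Definition _ :=
  GRing.ComUnitRing_isIntegral.Build (fps F) fps_mulf_eq0.

Lemma fps_const_is_zmod_morphism : zmod_morphism fps_const.
Proof. by move=> a b; apply: fpsP => -[|n] //=; rewrite subr0. Qed.
HB.instance Definition _ := GRing.isZmodMorphism.Build F (fps F) fps_const
  fps_const_is_zmod_morphism.

Lemma fps_const_is_monoid_morphism : monoid_morphism fps_const.
Proof.
split=> // a b; apply: fpsP => n /=; rewrite big_ord_recl /= subn0 big1 ?addr0.
  by case: n => //=; rewrite mulr0.
by move=> i _; rewrite mul0r.
Qed.
HB.instance Definition _ := GRing.isMonoidMorphism.Build F (fps F) fps_const
  fps_const_is_monoid_morphism.

Definition fpsX : fps F := Fps (fun n => (n == 1%N)%:R).

Lemma fps_coefXM f n : fpsc (fpsX * f) n = if n is n'.+1 then fpsc f n' else 0.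
Proof.
rewrite /= big_ord_recl /= mul0r add0r; case: n => [|n]; first by rewrite big_ord0.
by rewrite big_ord_recl /= mul1r subSS subn0 big1 ?addr0 // => i _; rewrite mul0r.
Qed.

Lemma fps_coefXnM k f n :
  fpsc (fpsX ^+ k * f) n = if (k <= n)%N then fpsc f (n - k) else 0.
Proof.
elim: k n => [|k IH] n; first by rewrite mul1r subn0.
by rewrite exprS -mulrA fps_coefXM; case: n => [|n] //; rewrite IH subSS.
Qed.

Lemma fpsX_neq0 : fpsX != 0.
Proof.
by apply/eqP => /(congr1 ((@fpsc F)^~ 1%N))/eqP; rewrite /= oner_eq0.
Qed.

End FpsRing.

(* The field F((t)) of Laurent series, as the fraction field of F[[t]]. With   *)
(* t = 1/theta this is K_oo.                                                  *)
Definition laurent (F : fieldType) := {fraction fps F}.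

Section Laurent.
Variable F : fieldType.

HB.instance Definition _ := GRing.Field.on (laurent F).

Definition fps_laurent (f : fps F) : laurent F := FracField.tofrac f.
HB.instance Definition _ := GRing.RMorphism.copy fps_laurent (@FracField.tofrac (fps F)).

Lemma fps_laurent_eq0 f : (fps_laurent f == 0) = (f == 0).
Proof. exact: tofrac_eq0. Qed.

(* t-adic topology: a neighbourhood basis of x is given by the x + t^N F[[t]]. *)
Definition laurent_nbhs (x : laurent F) : set_system (laurent F) :=
  [set A | exists N, forall f, A (x + fps_laurent (fpsX F ^+ N * f))].

HB.instance Definition _ := isPointed.Build (laurent F) 0.
HB.instance Definition _ := hasNbhs.Build (laurent F) laurent_nbhs.

Lemma laurent_nbhs_singleton (x : laurent F) A : nbhs x A -> A x.
Proof. by move=> [N /(_ 0)]; rewrite mulr0 rmorph0 addr0. Qed.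

Lemma laurent_nbhs_filter (x : laurent F) : ProperFilter (nbhs x).
Proof.
apply: Build_ProperFilter_ex; first by move=> A /laurent_nbhs_singleton; exists x.
split; first by exists 0%N.
  move=> A B [M hM] [N hN]; exists (M + N)%N => f.
  split; first by rewrite exprD -mulrA.
  by rewrite addnC exprD -mulrA.
by move=> A B AB [N hN]; exists N => f; apply: AB.
Qed.

Lemma laurent_nbhs_nbhs (x : laurent F) A : nbhs x A -> nbhs x (nbhs^~ A).
Proof.
by move=> [N hN]; exists N => f; exists N => g; rewrite -addrA -rmorphD -mulrDr.
Qed.

HB.instance Definition _ := Nbhs_isNbhsTopological.Build (laurent F)
  laurent_nbhs_filter laurent_nbhs_singleton laurent_nbhs_nbhs.

Lemma laurent_hausdorff : hausdorff_space (laurent F).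
Proof.
move=> x y clxy; apply/eqP; rewrite -subr_eq0.
have near N : exists f, x - y = fps_laurent (fpsX F ^+ N * f).
  have [||_ [[f _ <-] [g _ eqg]]] := clxy
      [set x + fps_laurent (fpsX F ^+ N * f) | f in setT]
      [set y + fps_laurent (fpsX F ^+ N * f) | f in setT].
  - by exists N => f; exists f.
  - by exists N => f; exists f.
  exists (g - f); rewrite mulrBr rmorphB /=; apply/eqP.
  by rewrite subr_eq addrAC eq_sym subr_eq addrC eqg.
have [a [b [b0 xy]]] := fracP (x - y : {fraction fps F}).
suff -> : x - y = 0 by [].
rewrite xy; suff -> : a = 0 by rewrite rmorph0 mul0r.
apply: fpsP => n; have [f] := near n.+1; rewrite xy => /eqP.
have Lb0 : fps_laurent b != 0 by rewrite fps_laurent_eq0.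
rewrite -(inj_eq (mulIf Lb0)) divfK // -rmorphM /= -subr_eq0 -rmorphB.
rewrite fps_laurent_eq0 subr_eq0 => /eqP ->.
by rewrite -mulrA fps_coefXnM ltnn.
Qed.

End Laurent.

Section FracLift.
Variables (R : idomainType) (E : fieldType) (f : {rmorphism R -> E}).

Definition frac_lift (x : {fraction R}) : E := f \n_(repr x) / f \d_(repr x).

Hypothesis f_inj : injective f.

Let f_neq0 b : b != 0 -> f b != 0.
Proof. by move=> b0; rewrite -(rmorph0 f) (inj_eq f_inj). Qed.

Lemma frac_liftE a b : b != 0 ->
  frac_lift (FracField.tofrac a / FracField.tofrac b) = f a / f b.
Proof.
move=> b0; rewrite /frac_lift.
set x : {fraction R} := FracField.tofrac a / FracField.tofrac b.
have d0 : \d_(repr x) != 0 by exact: denom_ratioP.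
have tf0 (c : R) : c != 0 -> FracField.tofrac c != 0 by rewrite tofrac_eq0.
apply/eqP; rewrite eqr_div ?f_neq0 // -!rmorphM (inj_eq f_inj) /=.
by rewrite -tofrac_eq !rmorphM /= -eqr_div ?tf0 // -frac_reprE.
Qed.

Lemma frac_lift_is_zmod_morphism : zmod_morphism frac_lift.
Proof.
move=> x y; have [a [b [b0 ->]]] := fracP x; have [c [d [d0 ->]]] := fracP y.
have tf0 (e : R) : e != 0 -> FracField.tofrac e != 0 by rewrite tofrac_eq0.
have -> : FracField.tofrac a / FracField.tofrac b
    - FracField.tofrac c / FracField.tofrac d
  = FracField.tofrac (a * d - c * b) / FracField.tofrac (b * d).
  by rewrite -mulNr addf_div ?tf0 // rmorphB !rmorphM mulNr.
rewrite !frac_liftE ?mulf_neq0 // -[in RHS]mulNr addf_div ?f_neq0 //.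
by rewrite rmorphB !rmorphM mulNr.
Qed.

Lemma frac_lift_is_monoid_morphism : monoid_morphism frac_lift.
Proof.
split=> [|x y].
  by rewrite -[1](@divr1 {fraction R}) -(rmorph1 (@FracField.tofrac R))
    frac_liftE ?oner_neq0 // !rmorph1 divr1.
have [a [b [b0 ->]]] := fracP x; have [c [d [d0 ->]]] := fracP y.
rewrite mulf_div -!rmorphM /= !frac_liftE ?mulf_neq0 //.
by rewrite mulf_div !rmorphM.
Qed.

End FracLift.

Section RationalFunctions.
Variable F : fieldType.

(* K = F(theta), with theta = 'X *)
Definition ratfun := {fraction {poly F}}.
HB.instance Definition _ := GRing.Field.on ratfun.

Definition ratfunC (c : F) : ratfun := FracField.tofrac c%:P.
Definition theta : ratfun := FracField.tofrac 'X.

(* p |-> p(1/t) *)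
Definition poly_laurent (p : {poly F}) : laurent F :=
  (map_poly (@fps_laurent F \o @fps_const F) p).[(fps_laurent (fpsX F))^-1].

Lemma poly_laurent_is_zmod_morphism : zmod_morphism poly_laurent.
Proof. by move=> p q; rewrite /poly_laurent rmorphB hornerD hornerN. Qed.
HB.instance Definition _ := GRing.isZmodMorphism.Build {poly F} (laurent F)
  poly_laurent poly_laurent_is_zmod_morphism.

Lemma poly_laurent_is_monoid_morphism : monoid_morphism poly_laurent.
Proof.
by split=> [|p q]; rewrite /poly_laurent ?rmorph1 ?hornerC // rmorphM hornerM.
Qed.
HB.instance Definition _ := GRing.isMonoidMorphism.Build {poly F} (laurent F)
  poly_laurent poly_laurent_is_monoid_morphism.

Lemma poly_laurent_inj : injective poly_laurent.
Proof.
apply: raddf_inj => p /=; rewrite /poly_laurent horner_coef size_map_poly => p0.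
apply/eqP/negPn/negP => pn0; move: p0.
set t := fps_laurent (fpsX F); set n := (size p).-1.
have sp : size p = n.+1 by rewrite prednK // size_poly_gt0.
have t0 : t != 0 by rewrite fps_laurent_eq0 fpsX_neq0.
pose g (i : nat) := fpsX F ^+ (n - i) * fps_const p`_i.
move=> /(congr1 ( *%R (t ^+ n))); rewrite mulr0 mulr_sumr sp.
rewrite (eq_bigr (fun i : 'I_n.+1 => fps_laurent (g i))); last first.
  move=> i _; have ile : (i <= n)%N by rewrite -ltnS.
  rewrite coef_map /= exprVn -[in t ^+ n](subnK ile) exprD mulrC -!mulrA.
  rewrite [X in _ * X]mulrC -mulrA divff ?expf_neq0 // mulr1 mulrC.
  by rewrite /g rmorphM rmorphXn.
rewrite -rmorph_sum => /eqP; rewrite fps_laurent_eq0 => /eqP.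
have g_lt (i : nat) : (i < n)%N -> fpsc (g i) 0%N = 0.
  by move=> ilt; rewrite /g fps_coefXnM leqn0 subn_eq0 leqNgt ilt.
have g_n : fpsc (g n) 0%N = lead_coef p by rewrite /g fps_coefXnM subnn.
move=> /(congr1 ((@fpsc F)^~ 0%N)).
rewrite fpsc_sum big_ord_recr big1 => [|i _]; last exact: g_lt (ltn_ord i).
rewrite [X in X = _](_ : _ = lead_coef p) => [/eqP|]; last by rewrite -g_n -[RHS]add0r.
by rewrite -[X in _ == X]/(0 : F) lead_coef_eq0 (negbTE pn0).
Qed.

Definition ratfun_laurent (x : ratfun) : laurent F := frac_lift poly_laurent x.

HB.instance Definition _ := GRing.isZmodMorphism.Build ratfun (laurent F)
  ratfun_laurent (frac_lift_is_zmod_morphism poly_laurent_inj).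
HB.instance Definition _ := GRing.isMonoidMorphism.Build ratfun (laurent F)
  ratfun_laurent (frac_lift_is_monoid_morphism poly_laurent_inj).

Lemma ratfun_laurent_theta : ratfun_laurent theta = (fps_laurent (fpsX F))^-1.
Proof.
rewrite /ratfun_laurent /theta -[FracField.tofrac _](@divr1 {fraction {poly F}}).
rewrite -(rmorph1 (@FracField.tofrac {poly F})).
rewrite (frac_liftE poly_laurent_inj) ?oner_neq0 // rmorph1 divr1.
by rewrite /= /poly_laurent map_polyX hornerX.
Qed.

(* [laurent F] as a K-vector space, via the embedding of K                    *)
Definition ratfun_scale (c : ratfun) (x : laurent F) := ratfun_laurent c * x.

Lemma ratfun_scaleA a b x :
  ratfun_scale a (ratfun_scale b x) = ratfun_scale (a * b) x.
Proof. by rewrite /ratfun_scale mulrA rmorphM. Qed.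
Lemma ratfun_scale1 : left_id 1 ratfun_scale.
Proof. by move=> x; rewrite /ratfun_scale rmorph1 mul1r. Qed.
Lemma ratfun_scaleDr : right_distributive ratfun_scale +%R.
Proof. by move=> c x y; rewrite /ratfun_scale mulrDr. Qed.
Lemma ratfun_scaleDl x : {morph ratfun_scale^~ x : a b / a + b}.
Proof. by move=> a b; rewrite /ratfun_scale rmorphD mulrDl. Qed.

HB.instance Definition _ := GRing.Zmodule_isLmodule.Build ratfun (laurent F)
  ratfun_scaleA ratfun_scale1 ratfun_scaleDr ratfun_scaleDl.

Lemma ratfun_scaleE (c : ratfun) (x : laurent F) :
  c *: x = ratfun_laurent c * x.
Proof. by []. Qed.

End RationalFunctions.

Section Span.
Variables (K : fieldType) (V : lmodType K).

Definition lin_span (A : set V) : set V :=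
  [set v | exists (m : nat) (c : 'I_m -> K) (x : 'I_m -> V),
     (forall i, A (x i)) /\ v = \sum_(i < m) c i *: x i].

Definition lin_indep (m : nat) (b : 'I_m -> V) : Prop :=
  forall c : 'I_m -> K, \sum_(i < m) c i *: b i = 0 -> forall i, c i = 0.

Definition has_dim (A : set V) (m : nat) : Prop :=
  exists2 b : 'I_m -> V, lin_indep b & lin_span (range b) = A.

End Span.

Section ACMPL.
Variable F : finFieldType.

Definition ell (d : nat) : ratfun F :=
  \prod_(1 <= i < d.+1) (theta F - theta F ^+ (#|F| ^ i)).

(* The sum defining Li(eps; s), restricted to the indices with d_1 < N.       *)
Definition acmpl_psum (n : nat) (eps : 'I_n -> F) (s : 'I_n -> nat) (N : nat) :
    ratfun F :=
  \sum_(d : {ffun 'I_n -> 'I_N} |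
        [forall i : 'I_n, forall j : 'I_n, (i < j)%N ==> (d j < d i)%N])
    \prod_(i < n) (ratfunC (eps i) ^+ d i / ell (d i) ^+ s i).

(* The limit exists, because deg ell_d >= d, and is unique                     *)
(* ([laurent_hausdorff]).                                                     *)
Definition Li (n : nat) (eps : 'I_n -> F) (s : 'I_n -> nat) : laurent F :=
  limn (fun N => ratfun_laurent (acmpl_psum eps s N)).

(* (eps; s) has entries in F_q^* and N = {1, 2, ...}, and weight w.            *)
Definition acmpl_index (w n : nat) (eps : 'I_n -> F) (s : 'I_n -> nat) : Prop :=
  [/\ forall i, eps i != 0, forall i, (0 < s i)%N & (\sum_(i < n) s i)%N = w].

Definition acmpl (w : nat) : set (laurent F) :=
  [set x | exists (n : nat) (eps : 'I_n -> F) (s : 'I_n -> nat),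
     acmpl_index w eps s /\ x = Li eps s].

Definition AL (w : nat) : set (laurent F) := lin_span (acmpl w).

Definition AS (w : nat) : set (laurent F) :=
  [set x | exists (n : nat) (eps : 'I_n -> F) (s : 'I_n -> nat),
     [/\ acmpl_index w eps s, forall i, ~~ (#|F| %| s i)%N & x = Li eps s]].

End ACMPL.

Arguments acmpl : clear implicits.
Arguments AL : clear implicits.
Arguments AS : clear implicits.

(* The integers s(w). The argument [fuel] only serves to make the recursion   *)
(* structural; any fuel >= w gives the same value.                            *)
Fixpoint s_rec (q fuel w : nat) : nat :=
  if fuel is k.+1 then
    if (w < q)%N then ((q - 1) * q ^ (w - 1))%N
    else if w == q then ((q - 1) * (q ^ (q - 1) - 1))%N
    else ((q - 1) * (\sum_(1 <= i < q) s_rec q k (w - i)) + s_rec q k (w - q))%N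
  else 0%N.

Definition s_bound (q w : nat) : nat := s_rec q w w.

Lemma s_rec_fuel q k w : (1 < q)%N -> (0 < w <= k)%N -> s_rec q k w = s_bound q w.
Proof.
move=> q1; rewrite /s_bound; elim/ltn_ind: w k => w IH [|k] /andP[w0 wk].
  by rewrite leqn0 in wk; rewrite (eqP wk) in w0.
case: w w0 wk IH => // w _ wk IH.
have E j m : (0 < j)%N -> (j < w.+1)%N -> (w <= m)%N ->
    s_rec q m (w.+1 - j) = s_rec q (w.+1 - j) (w.+1 - j).
  move=> j0 jw wm; apply: IH; first by rewrite ltn_subrL j0.
  rewrite subn_gt0 jw (leq_trans _ wm) //=.
  by rewrite -ltnS ltn_subrL j0.
rewrite /=; case: ltnP => // qw; case: eqP => // /eqP nqw.
have ltqw : (q < w.+1)%N by rewrite ltn_neqAle eq_sym nqw.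
congr (_ * _ + _)%N; last by rewrite !(E q) // ltnW.
rewrite !big_nat; apply: eq_bigr => i /andP[i0 iq].
by rewrite !(E i) // (ltn_trans iq).
Qed.

Lemma s_boundE_lt q w : (0 < w < q)%N -> s_bound q w = ((q - 1) * q ^ (w - 1))%N.
Proof. by rewrite /s_bound; case: w => // w /andP[_ wq] /=; rewrite wq. Qed.

Lemma s_boundE_eq q : (1 < q)%N -> s_bound q q = ((q - 1) * (q ^ (q - 1) - 1))%N.
Proof. by rewrite /s_bound; case: q => // q _ /=; rewrite ltnn eqxx. Qed.

Lemma s_boundE_gt q w : (1 < q < w)%N -> s_bound q w =
  ((q - 1) * (\sum_(1 <= i < q) s_bound q (w - i)) + s_bound q (w - q))%N.
Proof.
move=> /andP[q1]; case: w => // w qw.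
rewrite {1}/s_bound /= ltnNge (ltnW qw) /= gtn_eqF //.
have E j : (0 < j)%N -> (j < w.+1)%N -> s_rec q w (w.+1 - j) = s_bound q (w.+1 - j).
  move=> j0 jw; apply: s_rec_fuel => //.
  by rewrite subn_gt0 jw -ltnS ltn_subrL j0.
congr (_ * _ + _)%N; last by rewrite E // ltnW.
rewrite !big_nat; apply: eq_bigr => i /andP[i0 iq].
by rewrite E // (ltn_trans iq).
Qed.

(* Main.v *)
From HB Require Import structures.
Require Import Defs.
From mathcomp Require Import all_boot all_algebra.
From mathcomp Require Import fraction finfield ring zify.
From mathcomp Require Import all_classical topology.

(* Encode an index (eps; s) as a word v in the letters (s_i, eps_i). The       *)
(* telescoping formula                                                         *)
(*   sum_(j <= d) ell_j^-(q-1) = ell_(d+1) / (ell_1 ell_d^q)                   *)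
(* gives, after multiplication by a truncated sum attached to v and insertion *)
(* of a prefix u, a linear relation                                            *)
(*   Li(u x_(q,e) y v) + Li(u (x_(q,e) . y) v) = ell_1 / e * (sum of Li's)     *)
(* (with a single term on the left when y v is empty). Modulo ell_1, a letter *)
(* of weight k q thus merges, up to sign, into the letter following it, and a *)
(* word ending with such a letter vanishes; by induction on the depth every   *)
(* Li of weight w is congruent modulo ell_1 to an element of the span of AS_w. *)
(* Nakayama's lemma removes the "modulo ell_1". The bound on the dimension is *)
(* the number of words of weight w with no letter of weight divisible by q.   *)

Set Implicit Arguments.
Unset Strict Implicit.
Unset Printing Implicit Defensive.

Import GRing.Theory.
Local Open Scope classical_set_scope.
Local Open Scope ring_scope.

(** The relation already holds for truncated sums, up to a shift of the truncation by one: [term_q]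
    and [psum_stuffle] give [psum_rel], [psum_rel_prefix] carries it past a prefix, and [wLi_rel]
    passes to the limit. Its right-hand side is [ell_1] times a combination with coefficients in F,
    so the reduction [reduces_word] discards only polynomial multiples of [ell_1]. As
    [ell_1 = theta - theta^q] vanishes at [theta = 0], the relations modulo the span of [AS_w] form
    a square system whose matrix specialises to the identity there; its determinant is nonzero, and
    [lin_span_nakayama] yields [lin_span_AS]. For the dimension, sorting words by their first letter
    ([size_words]) gives a recursion that [count_s_bound] identifies with [s(w)], and [has_dim_seq]
    extracts a basis. *)

(** * Linear spans, bases and Nakayama's lemma *)

Section Span.
Variables (K : fieldType) (V : lmodType K).
Implicit Types (A B : set V) (x y : V).

Lemma lin_span_sub A x : A x -> lin_span A x.
Proof. by move=> Ax; exists 1%N, (fun=> 1), (fun=> x); rewrite big_ord1 scale1r. Qed.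

Lemma lin_span0 A : lin_span A 0.
Proof.
by exists 0%N, (fun=> 0), (fun=> 0); split; [case | rewrite big_ord0].
Qed.

Lemma lin_spanD A x y : lin_span A x -> lin_span A y -> lin_span A (x + y).
Proof.
move=> [m [c [u [Au ->]]]] [n [d [v [Av ->]]]]; exists (m + n)%N.
exists (fun i => match fintype.split i with inl j => c j | inr j => d j end).
exists (fun i => match fintype.split i with inl j => u j | inr j => v j end).
split; first by move=> i; case: (fintype.split i).
rewrite big_split_ord /=; congr (_ + _); apply: eq_bigr => i _.
  by rewrite (unsplitK (inl _ i)).
by rewrite (unsplitK (inr _ i)).
Qed.

Lemma lin_spanZ A a x : lin_span A x -> lin_span A (a *: x).
Proof.
move=> [m [c [u [Au ->]]]]; exists m, (fun i => a * c i), u; split=> //.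
by rewrite scaler_sumr; apply: eq_bigr => i _; rewrite scalerA.
Qed.

Lemma lin_spanB A x y : lin_span A x -> lin_span A y -> lin_span A (x - y).
Proof.
by move=> Ax Ay; rewrite -scaleN1r; apply: lin_spanD => //; apply: lin_spanZ.
Qed.

Lemma lin_span_sum A (I : Type) (r : seq I) (v : I -> V) :
  (forall i, lin_span A (v i)) -> lin_span A (\sum_(i <- r) v i).
Proof.
move=> Av; elim: r => [|i r IH]; first by rewrite big_nil; apply: lin_span0.
by rewrite big_cons; apply: lin_spanD.
Qed.

Lemma lin_span_le A B : A `<=` lin_span B -> lin_span A `<=` lin_span B.
Proof.
move=> AB x [m [c [u [Au ->]]]].
by apply: lin_span_sum => i; apply/lin_spanZ/AB.
Qed.

Lemma eq_lin_span A B :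
  A `<=` lin_span B -> B `<=` lin_span A -> lin_span A = lin_span B.
Proof. by move=> AB BA; apply/seteqP; split; exact: lin_span_le. Qed.

(** Greedy extraction: a vector enters the basis only when it lies outside the span of those after
    it in the list. *)
Lemma has_dim_seq (vs : seq V) :
  exists2 d, has_dim (lin_span [set x | x \in vs]) d & (d <= size vs)%N.
Proof.
elim: vs => [|v vs [d [b b_free b_span] d_le]].
  exists 0%N => //; exists (fun=> 0); first by move=> c _ [].
  by apply: eq_lin_span => [x [[]]|x] //=; rewrite in_nil.
have [vS|vS] := pselect (lin_span [set x | x \in vs] v).
  exists d; last exact: leqW.
  exists b => //; rewrite b_span; apply: eq_lin_span => x /= xs.
    by apply: lin_span_sub => /=; rewrite inE xs orbT.
  by move: xs; rewrite inE => /predU1P[->//|xs]; apply: lin_span_sub.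
exists d.+1; last by rewrite ltnS.
pose b' (i : 'I_d.+1) := if unlift ord0 i is Some j then b j else v.
have b'S j : b' (lift ord0 j) = b j by rewrite /b' liftK.
have b'0 : b' ord0 = v by rewrite /b' unlift_none.
exists b' => [c|].
  rewrite big_ord_recl b'0; under eq_bigr do rewrite b'S.
  have [c0|c0] := eqVneq (c ord0) 0.
    rewrite c0 scale0r add0r => /b_free cS i.
    by case: (unliftP ord0 i) => [j|] ->.
  move=> /eqP; rewrite addr_eq0 => /eqP cv; case: vS; rewrite -b_span.
  rewrite -[v](scalerK c0) cv; apply/lin_spanZ.
  rewrite -scaleN1r; apply/lin_spanZ/lin_span_sum => i.
  by apply/lin_spanZ/lin_span_sub; exists i.
have le_b : lin_span (range b) `<=` lin_span (range b').
  by apply: lin_span_le => _ [i _ <-]; apply: lin_span_sub; exists (lift ord0 i).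
apply: eq_lin_span => [_ [i _ <-]|x /=].
  case: (unliftP ord0 i) => [j|] ->; rewrite ?b'S ?b'0; last first.
    by apply: lin_span_sub; rewrite /= mem_head.
  have : lin_span [set x | x \in vs] (b j).
    by rewrite -b_span; apply: lin_span_sub; exists j.
  apply: lin_span_le => x /= xs; apply: lin_span_sub.
  by rewrite /= inE xs orbT.
rewrite inE => /predU1P[->|xs].
  by apply: lin_span_sub; exists ord0.
by apply: le_b; rewrite b_span; apply: lin_span_sub.
Qed.

(* Nakayama's lemma modulo an element [a] killed by some ring morphism [ev]:   *)
(* the matrix [1 - a M] is invertible over [K], as [ev] maps its determinant   *)
(* to [1].                                                                     *)
Lemma lin_span_nakayama (R S : comNzRingType) (iota : {rmorphism R -> K})
    (ev : {rmorphism R -> S}) (a : R) A n (x : 'I_n -> V) (M : 'M[R]_n) :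
    injective iota -> ev a = 0 ->
    (forall i, lin_span A (x i - \sum_j iota (a * M i j) *: x j)) ->
  forall i, lin_span A (x i).
Proof.
move=> iota_inj eva Ax k; pose B := 1%:M - a *: M.
have detB : iota (\det B) != 0.
  rewrite -(rmorph0 iota) (inj_eq iota_inj); apply/eqP => /(congr1 ev)/eqP.
  rewrite -det_map_mx rmorph0 (_ : map_mx ev B = 1%:M) ?det1 ?oner_eq0 //.
  by apply/matrixP => i j; rewrite !mxE rmorphB rmorphM eva mul0r subr0 rmorph_nat.
have AB i : lin_span A (\sum_j iota (B i j) *: x j).
  rewrite (_ : \sum_j _ = x i - \sum_j iota (a * M i j) *: x j) //.
  under eq_bigr do rewrite !mxE rmorphB scalerBl.
  rewrite sumrB; congr (_ - _); rewrite (bigD1 i) //= eqxx rmorph1 scale1r.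
  rewrite big1 ?addr0 // => j ji.
  by rewrite eq_sym (negbTE ji) mulr0n rmorph0 scale0r.
rewrite -[x k](scalerK detB); apply: lin_spanZ.
have -> : iota (\det B) *: x k =
    \sum_i iota (\adj B k i) *: \sum_j iota (B i j) *: x j.
  under eq_bigr do rewrite scaler_sumr.
  rewrite exchange_big /=.
  transitivity (\sum_j iota ((\adj B *m B) k j) *: x j).
    rewrite mul_adj_mx (bigD1 k) //= mxE eqxx mulr1n big1 ?addr0 // => j jk.
    by rewrite mxE eq_sym (negbTE jk) mulr0n rmorph0 scale0r.
  apply: eq_bigr => j _; rewrite mxE rmorph_sum scaler_suml.
  by apply: eq_bigr => i _; rewrite scalerA rmorphM.
by apply: lin_span_sum => i; apply: lin_spanZ.
Qed.

End Span.

(** * Limits in the t-adic topology *)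

Section LaurentLimit.
Variable F : fieldType.
Implicit Types (u v : nat -> laurent F) (l m : laurent F) (f : fps F).

Definition converges u l := forall N, exists M, forall n, (M <= n)%N ->
  exists f, u n = l + fps_laurent (fpsX F ^+ N * f).

Lemma converges_lim u l : converges u l -> limn u = l.
Proof.
move=> ul; apply: cvg_lim; first exact: laurent_hausdorff.
move=> A [N NA]; have [M uM] := ul N.
by exists M => // n /= /uM[f ->].
Qed.

Lemma converges_cst l : converges (fun=> l) l.
Proof. by move=> N; exists 0%N => n _; exists 0; rewrite mulr0 rmorph0 addr0. Qed.

Lemma convergesD u v l m :
  converges u l -> converges v m -> converges (fun n => u n + v n) (l + m).
Proof.
move=> ul vm N; have [M1 uM] := ul N; have [M2 vM] := vm N.
exists (maxn M1 M2) => n; rewrite geq_max => /andP[/uM[f ->] /vM[g ->]].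
by exists (f + g); rewrite mulrDr rmorphD addrACA.
Qed.

Lemma converges_shift u l : converges u l -> converges (fun n => u n.+1) l.
Proof. by move=> ul N; have [M uM] := ul N; exists M => n /leqW/uM. Qed.

(** A factor [c] with a pole of order at most [k] in [t] costs [k] orders of precision. *)
Lemma converges_mul (c : laurent F) k f u l :
    c * fps_laurent (fpsX F ^+ k) = fps_laurent f ->
  converges u l -> converges (fun n => c * u n) (c * l).
Proof.
move=> cf ul N; have [M uM] := ul (k + N)%N; exists M => n /uM[g ->].
exists (f * g); rewrite mulrDr exprD -mulrA rmorphM mulrA cf -rmorphM.
by rewrite mulrCA.
Qed.

Lemma fps_valuation N f : (forall i, (i < N)%N -> fpsc f i = 0) ->
  exists g, f = fpsX F ^+ N * g.
Proof.
move=> f0; exists (Fps (fun i => fpsc f (i + N))); apply: fpsP => n.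
by rewrite fps_coefXnM; case: leqP => [le_Nn|/f0] //=; rewrite subnK.
Qed.

(** Only the terms with [d <= n] reach the coefficient of degree [n], so each coefficient of the
    limit is a finite sum. *)
Lemma converges_series (h : nat -> fps F) : exists l,
  converges (fun N => fps_laurent (\sum_(d < N) fpsX F ^+ d * h d)) l.
Proof.
pose g := Fps (fun n => \sum_(d < n.+1) fpsc (h d) (n - d)).
exists (fps_laurent g) => N; exists N => n le_Nn.
have [i ltiN|f fE] := @fps_valuation N (\sum_(d < n) fpsX F ^+ d * h d - g).
  rewrite [LHS](_ : _ = fpsc (\sum_(d < n) fpsX F ^+ d * h d) i - fpsc g i) //.
  rewrite fpsc_sum; apply/eqP; rewrite subr_eq0; apply/eqP; rewrite [RHS]/=.
  rewrite (big_ord_widen_cond n predT (fun d => fpsc (h d) (i - d)%N)); last first.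
    exact: leq_trans ltiN le_Nn.
  rewrite [RHS]big_mkcond; apply: eq_bigr => d _.
  by rewrite fps_coefXnM ltnS.
by exists f; rewrite -fE rmorphB addrC subrK.
Qed.

End LaurentLimit.

(** * Rational functions as Laurent series *)

Section LaurentEmbedding.
Variable F : fieldType.

Definition ratfun_poly (p : {poly F}) : ratfun F := FracField.tofrac p.
HB.instance Definition _ :=
  GRing.RMorphism.copy ratfun_poly (@FracField.tofrac {poly F}).

Lemma ratfun_poly_inj : injective ratfun_poly.
Proof. by move=> p q /eqP; rewrite tofrac_eq => /eqP. Qed.

Lemma ratfunC_poly (c : F) : ratfunC c = ratfun_poly c%:P. Proof. by []. Qed.

Lemma theta_poly : theta F = ratfun_poly 'X. Proof. by []. Qed.

Lemma ratfun_laurent_poly p : ratfun_laurent (ratfun_poly p) = poly_laurent p.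
Proof.
rewrite -[ratfun_poly p](@divr1 {fraction {poly F}}).
rewrite -(rmorph1 (@FracField.tofrac {poly F})) /ratfun_laurent.
by rewrite (frac_liftE (@poly_laurent_inj F)) ?oner_neq0 // rmorph1 divr1.
Qed.

Lemma ratfun_laurentC (c : F) : ratfun_laurent (ratfunC c) = fps_laurent (fps_const c).
Proof.
by rewrite ratfunC_poly ratfun_laurent_poly /poly_laurent map_polyC hornerC.
Qed.

Lemma theta_sub_exp_neq0 m : (1 < m)%N -> theta F - theta F ^+ m != 0.
Proof.
move=> m1; rewrite theta_poly -rmorphXn -rmorphB -(rmorph0 ratfun_poly).
rewrite (inj_eq ratfun_poly_inj); apply/eqP => /(congr1 (fun p : {poly F} => p`_1)).
by rewrite coefB coefX coefXn coef0 (ltn_eqF m1) subr0 => /eqP; rewrite oner_eq0.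
Qed.

Let t : laurent F := fps_laurent (fpsX F).
Let t_neq0 : t != 0. Proof. by rewrite fps_laurent_eq0 fpsX_neq0. Qed.

Lemma laurent_theta_sub_exp m : (0 < m)%N ->
  ratfun_laurent (theta F - theta F ^+ m) * fps_laurent (fpsX F ^+ m) =
  fps_laurent (fpsX F ^+ m.-1 - 1).
Proof.
case: m => // m _; rewrite rmorphB rmorphXn /=.
rewrite ratfun_laurent_theta rmorphB rmorph1 !rmorphXn -/t mulrBl exprVn.
by rewrite mulVf ?expf_neq0 // exprS mulrA mulVf // mul1r.
Qed.

Lemma fps_geometric k : (0 < k)%N -> exists g : fps F, (fpsX F ^+ k - 1) * g = 1.
Proof.
move=> k0; exists (- Fps (fun n => (k %| n)%:R)); apply: fpsP => n.
rewrite mulrN mulrBl mul1r opprB.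
rewrite -[LHS]/((k %| n)%:R - fpsc (fpsX F ^+ k * Fps (fun n => (k %| n)%:R)) n).
rewrite fps_coefXnM; case: leqP => [kn|nk] /=.
  by rewrite dvdn_subl ?dvdnn // subrr gtn_eqF // (leq_trans k0).
by rewrite subr0; case: n nk => [|n] nk; rewrite ?dvdn0 ?gtnNdvd.
Qed.

(** [theta - theta^m = t^-m (t^(m-1) - 1)], where the second factor is a unit of F[[t]]. Of the [m]
    factors [t] of the inverse, one is enough for convergence. *)
Lemma laurent_theta_sub_exp_inv m : (1 < m)%N -> exists f,
  ratfun_laurent (theta F - theta F ^+ m)^-1 = fps_laurent (fpsX F * f).
Proof.
move=> m1; have [g gE] := @fps_geometric m.-1 (ltac:(by case: m m1 => [|[]])).
exists (fpsX F ^+ m.-1 * g); rewrite mulrA -exprS prednK ?(ltnW m1) //.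
have nz : ratfun_laurent (theta F - theta F ^+ m) != 0.
  by rewrite fmorph_eq0 theta_sub_exp_neq0.
apply: (mulfI nz); rewrite -rmorphM mulfV ?theta_sub_exp_neq0 // rmorph1.
by rewrite rmorphM mulrA laurent_theta_sub_exp ?(ltnW m1) // -rmorphM gE rmorph1.
Qed.

End LaurentEmbedding.

(** * Nested sums of words, telescoping and the stuffle product *)

Section PowerSums.
Variable F : finFieldType.
Local Notation q := #|F|.
Local Notation letter := (nat * F)%type.
Local Notation word := (seq letter).
Implicit Types (x y : letter) (u v z : word).

Lemma ell0 : ell F 0 = 1.
Proof. by rewrite /ell big_geq. Qed.

Lemma ellS d : ell F d.+1 = ell F d * (theta F - theta F ^+ (q ^ d.+1)).
Proof. by rewrite /ell big_nat_recr. Qed.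

Lemma theta_sub_card_neq0 d : theta F - theta F ^+ (q ^ d.+1) != 0.
Proof. by rewrite theta_sub_exp_neq0 // -(expn0 q) ltn_exp2l // finNzRing_gt1. Qed.

Lemma ell_neq0 d : ell F d != 0.
Proof.
elim: d => [|d IH]; first by rewrite ell0 oner_neq0.
by rewrite ellS mulf_neq0 ?theta_sub_card_neq0.
Qed.

Lemma ell1 : ell F 1 = theta F - theta F ^+ q.
Proof. by rewrite ellS ell0 mul1r expn1. Qed.

Lemma theta_frobenius d : (theta F - theta F ^+ (q ^ d)) ^+ q =
  theta F ^+ q - theta F ^+ (q ^ d.+1).
Proof.
have [p p_pr pF] := finPcharP F.
have pK : p \in [pchar (ratfun F)].
  rewrite inE p_pr /= -(rmorph_nat (@ratfun_poly F)) -polyC_natr.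
  by rewrite (pcharf0 pF) polyC0 rmorph0.
have qK : [pchar (ratfun F)].-nat q.
  by rewrite (card_pprimeChar pF) pnatX (eq_pnat _ (pcharf_eq pK)) pnat_id.
by rewrite exprDn_pchar // exprNn_pchar // -exprM -expnSr.
Qed.

Definition term x d : ratfun F := ratfunC x.2 ^+ d / ell F d ^+ x.1.

(** Truncated Li of a word, by recursion on the largest index; products and prefixes can then be
    handled by induction. *)
Fixpoint psum v N : ratfun F :=
  if v is x :: v' then \sum_(d < N) term x d * psum v' d else 1.

Definition letter_mul x y : letter := ((x.1 + y.1)%N, x.2 * y.2).

Lemma ratfunCM (a b : F) : ratfunC (a * b) = ratfunC a * ratfunC b.
Proof. by rewrite !ratfunC_poly polyCM rmorphM. Qed.

Lemma ratfunC1 : ratfunC 1 = 1 :> ratfun F.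
Proof. by rewrite ratfunC_poly rmorph1. Qed.

Lemma term_mul x y d : term (letter_mul x y) d = term x d * term y d.
Proof. by rewrite /term /= ratfunCM exprMn exprD invfM mulrACA. Qed.

Lemma psumS x v N : psum (x :: v) N.+1 = psum (x :: v) N + term x N * psum v N.
Proof. by rewrite /= big_ord_recr. Qed.

Lemma psum0 x v : psum (x :: v) 0 = 0.
Proof. by rewrite /= big_ord0. Qed.

Lemma psum_nil N : psum [::] N = 1. Proof. by []. Qed.

(* Telescoping: by the Frobenius,                                              *)
(* [ell_d.+1 ^ q.+1 + ell_1 ell_d.+1 ell_d ^ q = ell_d.+2 ell_d ^ q].             *)
Lemma psum_q1 d :
  psum [:: ((q - 1)%N, 1)] d.+1 = ell F d.+1 / (ell F 1 * ell F d ^+ q).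
Proof.
have q1 : (0 < q)%N := ltnW (finNzRing_gt1 F).
have termE i : term ((q - 1)%N, 1) i = ell F i / ell F i ^+ q.
  rewrite /term /= ratfunC1 expr1n mul1r -[in RHS](subnK q1) exprD expr1.
  by rewrite invfM mulrCA divff ?ell_neq0 // mulr1.
elim: d => [|d IH].
  by rewrite psumS psum0 psum_nil termE ell0 expr1n !mulr1 divr1 add0r divff // ell_neq0.
rewrite psumS IH termE psum_nil mulr1.
have e1 := ell_neq0 1; have ed := ell_neq0 d; have eS := ell_neq0 d.+1.
(* The fraction is expanded by the [q]-th power of the last factor of [ell_(d+1)], which brings both
   terms over [ell_1 ell_(d+1)^q]. *)
have -> : ell F d.+1 / (ell F 1 * ell F d ^+ q) =
    ell F d.+1 * (theta F ^+ q - theta F ^+ (q ^ d.+2)) /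
    (ell F 1 * ell F d.+1 ^+ q).
  rewrite [in RHS](ellS d) [in RHS]exprMn (theta_frobenius d.+1).
  have nz : theta F ^+ q - theta F ^+ (q ^ d.+2) != 0.
    by rewrite -(theta_frobenius d.+1) (expf_neq0 _ (theta_sub_card_neq0 d)).
  by rewrite [in RHS](mulrA (ell F 1)) -[in RHS]mulf_div (divff nz) mulr1 -(ellS d).
rewrite [in RHS]ellS.
have -> : ell F d.+1 / ell F d.+1 ^+ q =
    ell F 1 * ell F d.+1 / (ell F 1 * ell F d.+1 ^+ q).
  by rewrite -[in RHS]mulf_div (divff e1) mul1r.
by rewrite -mulrDl (mulrC (ell F 1) (ell F d.+1)) -mulrDr ell1 [in LHS]addrC addrA subrK.
Qed.

(** Multiplying the telescoped sum [ell_(d+1) / (ell_1 ell_d^q)] by [e^(d+1) / ell_(d+1)] leaves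
    [e / ell_1] times the term of [(q, e)] at [d]. *)
Lemma term_q (e : F) d : e != 0 -> term (q, e) d =
  ratfunC e^-1 * ell F 1 * (term (1%N, e) d.+1 * psum [:: ((q - 1)%N, 1)] d.+1).
Proof.
move=> e0; rewrite psum_q1 /term /= expr1 exprS.
have -> : ratfunC e^-1 * ell F 1 * (ratfunC e * ratfunC e ^+ d / ell F d.+1 *
    (ell F d.+1 / (ell F 1 * ell F d ^+ q))) =
  (ratfunC e^-1 * ratfunC e) * (ratfunC e ^+ d / ell F d ^+ q) *
    (ell F 1 / ell F 1) * (ell F d.+1 / ell F d.+1).
  by rewrite invfM; ring.
by rewrite !divff ?ell_neq0 // -ratfunCM mulVf // ratfunC1 !mulr1 mul1r.
Qed.

(** Stuffle product of one letter with a word: the index of [x] lies above, at, or below that of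
    [y]. *)
Fixpoint stuffle x v : seq word :=
  if v is y :: v' then
    [:: x :: v, letter_mul x y :: v' & map (cons y) (stuffle x v')]
  else [:: [:: x]].

Lemma psum_sumr y (L : seq word) N :
  \sum_(z <- map (cons y) L) psum z N = \sum_(d < N) term y d * \sum_(z <- L) psum z d.
Proof. by rewrite big_map exchange_big /=; under eq_bigr do rewrite -mulr_sumr. Qed.

Lemma psum_stuffle x v N :
  psum [:: x] N * psum v N = \sum_(z <- stuffle x v) psum z N.
Proof.
elim: v N => [|y v IH] N; first by rewrite big_seq1 mulr1.
rewrite [stuffle _ _]/= !big_cons psum_sumr.
pose T M := \sum_(d < M) term y d * \sum_(z <- stuffle x v) psum z d.
rewrite -/(T N); elim: N => [|N IHN].
  by rewrite !psum0 /T big_ord0 mul0r !addr0.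
have -> : T N.+1 = T N + term y N * (psum [:: x] N * psum v N).
  by rewrite /T big_ord_recr IH.
rewrite !psumS term_mul psum_nil mulr1.
transitivity (psum [:: x] N * psum (y :: v) N + term x N * psum (y :: v) N +
  (term x N * term y N * psum v N) + term y N * (psum [:: x] N * psum v N)).
  by ring.
by rewrite IHN; ring.
Qed.

End PowerSums.

(** * Words versus indices, and convergence of the series *)

Section Bridge.
Variable F : finFieldType.
Local Notation q := #|F|.
Local Notation letter := (nat * F)%type.
Local Notation word := (seq letter).
Implicit Types (x y : letter) (u v z : word).

Section Decreasing.
Variable N : nat.

Definition decreasing n (d : {ffun 'I_n -> 'I_N}) :=
  [forall i : 'I_n, forall j : 'I_n, (i < j)%N ==> (d j < d i)%N].

Definition ffun_cons n (p : 'I_N * {ffun 'I_n -> 'I_N}) : {ffun 'I_n.+1 -> 'I_N} :=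
  [ffun i => if unlift ord0 i is Some j then p.2 j else p.1].

Lemma ffun_cons0 n p : @ffun_cons n p ord0 = p.1.
Proof. by rewrite ffunE unlift_none. Qed.

Lemma ffun_consS n p i : @ffun_cons n p (lift ord0 i) = p.2 i.
Proof. by rewrite ffunE liftK. Qed.

Lemma ffun_cons_bij n : bijective (@ffun_cons n).
Proof.
exists (fun d : {ffun 'I_n.+1 -> 'I_N} =>
  (d ord0, [ffun i => d (lift ord0 i)])) => [[k d]|d].
  rewrite ffun_cons0; congr (_, _); apply/ffunP => i.
  by rewrite ffunE ffun_consS.
apply/ffunP => i; case: (unliftP ord0 i) => [j|] ->.
  by rewrite ffun_consS ffunE.
by rewrite ffun_cons0.
Qed.

Lemma decreasing_cons n p M :
  decreasing (ffun_cons p) && [forall i, @ffun_cons n p i < M]%N =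
  (p.1 < M)%N && (decreasing p.2 && [forall i, p.2 i < p.1]%N).
Proof.
apply/andP/and3P => [[/forallP dec /forallP lt]|[ltM /forallP dec /forallP lt]].
  split; first by have := lt ord0; rewrite ffun_cons0.
    apply/forallP => i; apply/forallP => j; apply/implyP => ij.
    have /forallP/(_ (lift ord0 j))/implyP := dec (lift ord0 i).
    by rewrite !ffun_consS; apply.
  apply/forallP => i; have /forallP/(_ (lift ord0 i))/implyP := dec ord0.
  by rewrite ffun_consS ffun_cons0; apply.
split; last first.
  apply/forallP => i; case: (unliftP ord0 i) => [j|] ->.
    by rewrite ffun_consS (ltn_trans (lt j)).
  by rewrite ffun_cons0.
apply/forallP => i; apply/forallP => j; apply/implyP.
case: (unliftP ord0 i) => [i'|] ->; case: (unliftP ord0 j) => [j'|] -> //.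
  by rewrite !ffun_consS /= => ij; have /forallP/(_ j')/implyP := dec i'; apply.
by rewrite ffun_consS ffun_cons0.
Qed.

(** The codomain ['I_N] stays fixed while the recursion lowers the bound [M] to the largest index,
    hence two separate bounds. *)
Lemma psum_ffun n (eps : 'I_n -> F) (s : 'I_n -> nat) M : (M <= N)%N ->
  psum [seq (s i, eps i) | i <- enum 'I_n] M =
  \sum_(d : {ffun 'I_n -> 'I_N} | decreasing d && [forall i, d i < M]%N)
    \prod_(i < n) term (s i, eps i) (d i).
Proof.
elim: n eps s M => [|n IH] eps s M leMN.
  have d0 : {ffun 'I_0 -> 'I_N} by apply: ffun0; rewrite card_ord.
  rewrite (big_pred1 d0) => [|d].
    by rewrite big_ord0 (_ : enum _ = [::]) //; apply/size0nil; rewrite size_enum_ord.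
  have -> : d = d0 by apply/ffunP => -[].
  by rewrite /= eqxx; apply/andP; split; apply/forallP => -[].
rewrite enum_ordSl /= -map_comp.
rewrite (reindex _ (onW_bij _ (@ffun_cons_bij n))) /=.
rewrite (eq_bigl _ _ (fun p => decreasing_cons p M)).
rewrite -(pair_big_dep (fun k : 'I_N => (k < M)%N)
  (fun k d => decreasing d && [forall i, d i < k]%N)
  (fun k d => \prod_(i < n.+1) term (s i, eps i) (ffun_cons (k, d) i))) /=.
rewrite (big_ord_widen_cond N predT (fun k => term (s ord0, eps ord0) k *
  psum (map (_ \o _) (enum 'I_n)) k)) //=.
apply: eq_bigr => k _.
rewrite (IH (eps \o lift ord0) (s \o lift ord0)); last exact/ltnW/ltn_ord.
rewrite mulr_sumr; apply: eq_bigr => d _.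
rewrite big_ord_recl ffun_cons0; congr (_ * _).
by apply: eq_bigr => i _; rewrite ffun_consS.
Qed.

End Decreasing.

Lemma acmpl_psumE n (eps : 'I_n -> F) (s : 'I_n -> nat) N :
  acmpl_psum eps s N = psum [seq (s i, eps i) | i <- enum 'I_n] N.
Proof.
rewrite (@psum_ffun N) //; apply: eq_bigl => d.
by rewrite andb_idr // => _; apply/forallP => i.
Qed.

Definition wLi v : laurent F := limn (fun N => ratfun_laurent (psum v N)).

Lemma Li_wLi n (eps : 'I_n -> F) (s : 'I_n -> nat) :
  Li eps s = wLi [seq (s i, eps i) | i <- enum 'I_n].
Proof. by rewrite /Li /wLi; under eq_fun do rewrite acmpl_psumE. Qed.

Lemma ell_laurent d : exists f,
  ratfun_laurent (ell F d)^-1 = fps_laurent (fpsX F ^+ d * f).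
Proof.
elim: d => [|d [f fE]].
  by exists 1; rewrite ell0 invr1 mulr1 expr0 !rmorph1.
have q1 : (1 < q ^ d.+1)%N by rewrite -(expn0 q) ltn_exp2l // finNzRing_gt1.
have [g gE] := laurent_theta_sub_exp_inv F q1.
by exists (f * g); rewrite ellS invfM rmorphM /= fE gE -rmorphM mulrACA -exprSr.
Qed.

(** A positive exponent provides at least one factor [1 / ell_d], which already supplies [t^d]. *)
Lemma term_laurent x d : (0 < x.1)%N -> exists f,
  ratfun_laurent (term x d) = fps_laurent (fpsX F ^+ d * f).
Proof.
case: x => [[|s] e] // _; have [f fE] := ell_laurent d.
exists (fps_const e ^+ d * (f * (fpsX F ^+ d * f) ^+ s)).
rewrite /term /= -exprVn rmorphM !rmorphXn.
rewrite /= fE ratfun_laurentC -!rmorphXn -rmorphM exprS.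
by congr fps_laurent; ring.
Qed.

Definition positive v := all (fun x => 0 < x.1)%N v.

Lemma psum_laurent v N : positive v -> exists f,
  ratfun_laurent (psum v N) = fps_laurent f.
Proof.
elim: v N => [|x v IH] N /=; first by exists 1; rewrite !rmorph1.
move=> /andP[x0 v0]; elim: N => [|N [f fE]].
  by exists 0; rewrite big_ord0 !rmorph0.
have [g gE] := IH N v0; have [h hE] := term_laurent N x0.
exists (f + fpsX F ^+ N * h * g); rewrite big_ord_recr rmorphD /= fE rmorphM /= gE hE.
by rewrite -rmorphM -rmorphD.
Qed.

Lemma psum_converges v : positive v ->
  converges (fun N => ratfun_laurent (psum v N)) (wLi v).
Proof.
suff ex : positive v -> exists l, converges (fun N => ratfun_laurent (psum v N)) l.
  by move=> /ex[l ul]; rewrite /wLi (converges_lim ul).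
case: v => [|x v] /=; first by exists (ratfun_laurent 1); apply: converges_cst.
move=> /andP[x0 v0].
have /choice[h hE] d : exists f, ratfun_laurent (term x d * psum v d) =
    fps_laurent (fpsX F ^+ d * f).
  have [g gE] := psum_laurent d v0; have [f fE] := term_laurent d x0.
  by exists (f * g); rewrite rmorphM /= fE gE -rmorphM mulrA.
have [l hl] := converges_series h; exists l.
rewrite (_ : (fun N => _) = fun N => fps_laurent (\sum_(d < N) fpsX F ^+ d * h d)) //.
apply/funext => N; rewrite !rmorph_sum.
by apply: eq_bigr => d _ /=; rewrite hE.
Qed.

End Bridge.

(** * The recursion for [s(w)] *)

Section Counting.
Variables (q : nat) (g : nat -> nat).
Hypotheses (q1 : (1 < q)%N) (g0 : g 0 = 1%N).
(** Words with no letter of weight divisible by [q], sorted by their first letter, are counted this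
    way. *)
Hypothesis gE : forall w, (0 < w)%N ->
  g w = ((q - 1) * \sum_(1 <= s < w.+1 | ~~ (q %| s)) g (w - s))%N.

Let sum_lt w : (w <= q)%N ->
  (\sum_(1 <= s < w | ~~ (q %| s)) g (w - s) = \sum_(1 <= s < w) g (w - s))%N.
Proof.
move=> wq; rewrite big_nat_cond [RHS]big_nat_cond; apply: eq_bigl => s.
by case: (boolP (1 <= s < w)%N) => //= /andP[s0 sw]; rewrite gtnNdvd // (leq_trans sw).
Qed.

Let sum_rev w : (\sum_(1 <= s < w) g (w - s) = \sum_(1 <= s < w) g s)%N.
Proof.
rewrite big_nat_rev /= [LHS]big_nat [RHS]big_nat; apply: eq_bigr => s /andP[s0 sw].
by congr g; lia.
Qed.

Let g_lt w : (0 < w < q)%N -> g w = ((q - 1) * \sum_(0 <= s < w) g s)%N.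
Proof.
move=> /andP[w0 wq]; rewrite gE //; congr (_ * _)%N.
rewrite big_mkcond big_nat_recr //= subnn gtnNdvd //= -big_mkcond sum_lt ?(ltnW wq) //.
by rewrite sum_rev [RHS]big_ltn // addnC.
Qed.

(** Below [q] no weight is excluded: [g w] is [q - 1] times the sum of all earlier values, so each
    step multiplies the partial sum by [q]. *)
Let sum_g w : (w < q)%N -> (\sum_(0 <= s < w.+1) g s = q ^ w)%N.
Proof.
elim: w => [|w IH] wq; first by rewrite big_nat1 g0.
rewrite big_nat_recr //= g_lt ?wq // IH ?(ltnW wq) // expnS.
by rewrite -{1}[(q ^ w)%N]mul1n -mulnDl subnKC // ltnW.
Qed.

Lemma count_s_bound w : (0 < w)%N -> g w = s_bound q w.
Proof.
elim/ltn_ind: w => w IH w0; have [wq|wq|wq] := ltngtP w q.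
- rewrite s_boundE_lt ?w0 // g_lt ?w0 //; case: w w0 wq {IH} => // w _ wq.
  by rewrite sum_g ?(ltnW wq) // subSS subn0.
- rewrite s_boundE_gt ?q1 // gE //.
  (* Weight [q] is excluded; lowering the weights above [q] by [q] reproduces the recursion for
     [w - q]. *)
  have -> : (\sum_(1 <= s < w.+1 | ~~ (q %| s)) g (w - s) =
      \sum_(1 <= s < q) g (w - s) +
      \sum_(1 <= s < (w - q).+1 | ~~ (q %| s)) g (w - q - s))%N.
    rewrite (@big_cat_nat _ _ _ q) //=; [|lia|lia].
    congr (_ + _)%N.
      rewrite big_nat_cond [RHS]big_nat_cond; apply: eq_bigl => s.
      by case: (boolP (1 <= s < q)%N) => //= /andP[s0 sq]; rewrite gtnNdvd.
    rewrite big_mkcond big_ltn; last lia.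
    rewrite dvdnn /= add0n -big_mkcond /= -[q.+1]add1n -subSn 1?ltnW // big_addn.
    apply: eq_big => s; first by rewrite dvdn_addl.
    by rewrite addnC subnDA.
  rewrite mulnDr -[X in (_ + X)%N]gE ?subn_gt0 // IH ?subn_gt0 //; last lia.
  congr (_ * _ + _)%N; rewrite big_nat [RHS]big_nat.
  by apply: eq_bigr => s /andP[s0 sq]; rewrite IH //; lia.
(* Excluding the single letter of weight [q] removes [g 0 = 1] from the full sum [q^(q-1)]. *)
- rewrite wq s_boundE_eq // -wq gE // wq; congr (_ * _)%N.
  rewrite big_mkcond big_nat_recr //=; last lia.
  rewrite dvdnn addn0 -big_mkcond sum_lt // sum_rev.
  have := sum_g (ltac:(lia) : (q.-1 < q)%N); rewrite prednK 1?ltnW //.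
  by rewrite big_ltn 1?ltnW // g0 -(subn1 q) => <-; rewrite addKn.
Qed.

End Counting.

(** * The fundamental relation between words *)

Section Words.
Variable F : finFieldType.
Local Notation q := #|F|.
Local Notation letter := (nat * F)%type.
Local Notation word := (seq letter).
Implicit Types (x y b : letter) (u v z : word).

Definition valid_letter x := (0 < x.1)%N && (x.2 != 0).
Definition weight v := sumn (map fst v).
Definition valid (w : nat) v := all valid_letter v && (weight v == w).

Lemma valid_positive w v : valid w v -> positive v.
Proof. by move=> /andP[/allP vv _]; apply/allP => x /vv /andP[]. Qed.

Lemma valid_cons w x v : valid_letter x -> valid w v -> valid (x.1 + w) (x :: v).
Proof. by move=> vx /andP[vv /eqP <-]; rewrite /valid /= vx vv /=. Qed.

Lemma valid_letter_mul x y :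
  valid_letter x -> valid_letter y -> valid_letter (letter_mul x y).
Proof.
by move=> /andP[x0 x1] /andP[y0 y1]; rewrite /valid_letter /= addn_gt0 x0 mulf_neq0.
Qed.

Lemma valid_stuffle w x v : valid_letter x -> valid w v ->
  all (valid (x.1 + w)) (stuffle x v).
Proof.
move=> vx; elim: v w => [|y v IH] w vv.
  by rewrite /= andbT; apply: valid_cons.
have /andP[/= /andP[vy vv'] /eqP wE] := vv.
rewrite /= (valid_cons vx vv) -wE /=; apply/andP; split.
  rewrite /valid /= valid_letter_mul // vv' /=.
  by rewrite /weight /= addnA eqxx.
have vS : all (valid (x.1 + weight v)) (stuffle x v).
  by apply: IH; rewrite /valid vv' /=.
rewrite all_map; apply: sub_all vS => z /= vz.
by rewrite -[weight _]/(y.1 + weight v)%N addnCA; apply: valid_cons.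
Qed.

Section Relation.
Variables (e : F) (v : word).
Hypothesis e0 : e != 0.

(* The two words of the left-hand side of the fundamental relation            *)
(* [x_q v + (x_q . v_1) v_2 ... = ell_1 / e * x_1 (x_(q-1) * v)], where [*]    *)
(* is the stuffle product and [.] multiplies letters.                        *)
Definition rel_lhs : seq word :=
  if v is y :: v' then [:: (q, e) :: v; letter_mul (q, e) y :: v'] else [:: [:: (q, e)]].

Let coef := ratfunC e^-1 * ell F 1.
Let S := stuffle ((q - 1)%N, 1) v.

(** The two words cover a second index below or equal to the first: the inequality becomes weak,
    hence [d.+1]. *)
Lemma psum_rel_lhs N :
  \sum_(z <- rel_lhs) psum z N = \sum_(d < N) term (q, e) d * psum v d.+1.
Proof.
rewrite /rel_lhs; case: v => [|y v']; first by rewrite big_seq1.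
rewrite big_cons big_seq1; under [RHS]eq_bigr do rewrite psumS.
rewrite -big_split; apply: eq_bigr => d _; rewrite term_mul.
by rewrite /= mulrDr; congr (_ + _); rewrite mulrA.
Qed.

Lemma psum_rel N : \sum_(z <- rel_lhs) psum z N =
  coef * \sum_(z <- S) psum ((1%N, e) :: z) N.+1.
Proof.
rewrite psum_rel_lhs -(big_map (cons (1%N, e)) predT (fun z => psum z N.+1)).
(* The term of index 0 on the right vanishes, since the sum of [(q - 1, 1)] truncated at 0 is empty;
   the other indices are shifted by one. *)
rewrite psum_sumr big_ord_recl -psum_stuffle psum0 mul0r mulr0 add0r mulr_sumr.
by apply: eq_bigr => d _; rewrite -psum_stuffle term_q // !mulrA.
Qed.

Let rhs_valid w : valid w ((q, e) :: v) ->
  [/\ valid_letter (1%N, e), all (valid (w - 1)) S & (0 < w)%N].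
Proof.
move=> /andP[/= /andP[_ vv] /eqP wE]; have q1 := finNzRing_gt1 F.
have vS := @valid_stuffle (weight v) ((q - 1)%N, 1 : F) v.
split; [by rewrite /valid_letter /= | | by rewrite -wE addn_gt0 ltnW].
have -> : (w - 1 = (q - 1) + weight v)%N by rewrite addnBAC ?(ltnW q1) // -wE.
apply: vS.
  by rewrite /valid_letter /= subn_gt0 q1 oner_neq0.
by rewrite /valid vv /=.
Qed.

(** When [b] stands directly before [(q, e)] and has index [d], the right-hand side is truncated at
    [d.+1]. Its terms below [d] keep [(1, e)] after [b], and the one at [d] merges [(1, e)] into
    [b]: these are the two groups of words in [L]. Further letters of the prefix are put in front of
    the words of [L]. *)
Lemma psum_rel_prefix w b u : valid w (b :: u ++ (q, e) :: v) ->
  exists2 L, all (valid w) L & forall N,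
    \sum_(z <- [seq b :: u ++ z | z <- rel_lhs]) psum z N =
    coef * \sum_(z <- L) psum z N.
Proof.
elim: u w b => [|a u IH] w b /andP[/= /andP[vb vu] /eqP wE].
  have vv : valid (weight ((q, e) :: v)) ((q, e) :: v) by rewrite /valid eqxx /= vu.
  have [v1 vS w0] := rhs_valid vv; have [w' wE'] : exists w',
      weight ((q, e) :: v) = w'.+1 by exists (weight ((q, e) :: v)).-1; rewrite prednK.
  rewrite wE' subn1 /= in vS; rewrite -[weight _]/(b.1 + weight ((q, e) :: v))%N wE' in wE.
  exists ([seq b :: z | z <- [seq (1%N, e) :: z | z <- S]] ++
          [seq letter_mul b (1%N, e) :: z | z <- S]) => [|N].
    rewrite all_cat !all_map -wE; apply/andP; split; apply: sub_all vS => z vz.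
      by rewrite /= -add1n; apply: valid_cons vb _; apply: (valid_cons v1 vz).
    rewrite /= -add1n addnA; apply: (valid_cons (x := letter_mul b (1%N, e))) vz.
    exact: valid_letter_mul.
  rewrite psum_sumr big_cat /= !psum_sumr mulrDr !mulr_sumr -big_split.
  apply: eq_bigr => d _ /=; rewrite psum_rel psum_sumr term_mul.
  have -> : \sum_(z <- S) psum ((1%N, e) :: z) d.+1 =
      \sum_(z <- [seq (1%N, e) :: z | z <- S]) psum z d +
      term (1%N, e) d * \sum_(z <- S) psum z d.
    by rewrite big_map mulr_sumr -big_split; apply: eq_bigr => z _; rewrite psumS.
  by rewrite psum_sumr; ring.
have vu' : valid (weight (a :: u ++ (q, e) :: v)) (a :: u ++ (q, e) :: v).
  by rewrite /valid eqxx /= vu.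
have [L vL LE] := IH _ _ vu'; exists [seq b :: z | z <- L] => [|N].
  by rewrite all_map -wE; apply: sub_all vL => z; apply: valid_cons.
rewrite (map_comp (cons b) (fun z => a :: u ++ z)) !psum_sumr mulr_sumr.
by apply: eq_bigr => d _; rewrite LE mulrCA.
Qed.

Lemma coef_converges (f : nat -> ratfun F) l :
  converges (fun N => ratfun_laurent (f N)) l ->
  converges (fun N => ratfun_laurent (coef * f N)) (coef *: l).
Proof.
move=> fl; under eq_fun do rewrite rmorphM.
(* [ell_1] has a pole of order [q] in [t]. *)
apply: (@converges_mul _ _ q (fps_const e^-1 * (fpsX F ^+ q.-1 - 1))) fl.
rewrite /coef ell1 rmorphM /= -mulrA laurent_theta_sub_exp ?(ltnW (finNzRing_gt1 F)) //.
by rewrite ratfun_laurentC -rmorphM.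
Qed.

Lemma converges_psums w L : all (valid w) L ->
  converges (fun N => ratfun_laurent (\sum_(z <- L) psum z N)) (\sum_(z <- L) wLi z).
Proof.
elim: L => [_|z L IH /= /andP[vz vL]].
  under eq_fun do rewrite big_nil rmorph0.
  by rewrite big_nil; apply: converges_cst.
under eq_fun do rewrite big_cons rmorphD.
rewrite big_cons; apply: convergesD (IH vL).
exact/psum_converges/(valid_positive vz).
Qed.

Lemma valid_rel_lhs w u : valid w (u ++ (q, e) :: v) ->
  all (valid w) [seq u ++ z | z <- rel_lhs].
Proof.
move=> vw; have /andP[] := vw; rewrite all_cat /= => /and3P[vu ve vv] /eqP wE.
rewrite /rel_lhs; case: v vv vw wE => [|y v'] /= vv vw wE; rewrite vw //= andbT.
have /andP[vy vv'] := vv.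
rewrite /valid all_cat vu /= valid_letter_mul // vv' /= -wE /weight.
by rewrite !map_cat !sumn_cat /= !addnA eqxx.
Qed.

Lemma wLi_rel w u : valid w (u ++ (q, e) :: v) ->
  exists2 L, all (valid w) L &
    \sum_(z <- [seq u ++ z | z <- rel_lhs]) wLi z = coef *: \sum_(z <- L) wLi z.
Proof.
move=> vw; have vE := valid_rel_lhs vw; have cE := converges_psums vE.
case: u => [|b u] in vw vE cE *.
  have [v1 vS w0] := rhs_valid vw.
  have vL : all (valid w) [seq (1%N, e) :: z | z <- S].
    rewrite all_map; apply: sub_all vS => z vz.
    by have := valid_cons v1 vz; rewrite subnKC.
  exists [seq (1%N, e) :: z | z <- S] => //.
  rewrite -(converges_lim cE).
  (* Without a prefix the truncations differ by one, which the limit does not see. *)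
  rewrite -(converges_lim (coef_converges (converges_shift (converges_psums vL)))).
  by congr (limn _); apply/funext => N; rewrite map_id psum_rel big_map.
have [L vL LE] := psum_rel_prefix vw; exists L => //.
rewrite -(converges_lim cE) -(converges_lim (coef_converges (converges_psums vL))).
by congr (limn _); apply/funext => N; rewrite LE.
Qed.

End Relation.

End Words.

(** * Enumerating and counting the words of a given weight *)

Section Enumeration.
Variable F : finFieldType.
Local Notation q := #|F|.
Local Notation letter := (nat * F)%type.
Local Notation word := (seq letter).
Implicit Types (x y : letter) (u v z : word) (P : pred nat).

(* [words P k w] is complete as soon as [w < k]. *)
Fixpoint words P (k w : nat) : seq word :=
  if k is k'.+1 then
    if w == 0%N then [:: [::]]
    else flatten
      [seq [seq (s, e) :: v | e <- enum (predC1 (0 : F)), v <- words P k' (w - s)]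
      | s <- iota 1 w & P s]
  else [::].

Lemma mem_words P k (w : nat) v : (w < k)%N ->
  (v \in words P k w) = valid w v && all (fun x => P x.1) v.
Proof.
elim: k w v => // k IH w v; rewrite ltnS => wk /=.
case: eqP => [->|/eqP w0].
  rewrite inE; case: v => [//|x v]; apply/esym/negP.
  move=> /andP[/andP[/= /andP[/andP[x0 _] _]]].
  by rewrite /weight /= addn_eq0 -leqn0 leqNgt x0.
apply/flattenP/idP => [[_ /mapP[s sP ->]]|].
  move: sP; rewrite mem_filter mem_iota add1n ltnS => /and3P[Ps s0 sw].
  case/allpairsPdep => e [v' [e0 v'P ->]].
  rewrite mem_enum in e0; move: v'P; rewrite IH; last lia.
  move=> /andP[vv' Pv']; rewrite /= Ps Pv' !andbT -(subnKC sw).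
  by apply: (@valid_cons _ _ (s, e)) => //; rewrite /valid_letter s0.
case: v => [|[s e] v] /andP[/andP[/= + /eqP wE]].
  by rewrite -wE in w0.
move=> /andP[/andP[/= s0 e0] vv] /andP[Ps Pv].
have wE' : w = (s + weight v)%N by [].
exists [seq (s, e) :: v | e <- enum (predC1 (0 : F)), v <- words P k (w - s)].
  apply/mapP; exists s => //.
  by rewrite mem_filter mem_iota add1n ltnS Ps s0 wE' leq_addr.
apply/allpairsPdep; exists e, v; split=> //; first by rewrite mem_enum.
by rewrite wE' addKn IH ?/valid ?vv ?eqxx //; lia.
Qed.

Lemma words_fuel P k k' (w : nat) : (w < k)%N -> (w < k')%N -> words P k w = words P k' w.
Proof.
elim: k k' w => // k IH [//|k'] w; rewrite !ltnS => wk wk' /=.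
case: eqP => // /eqP w0; congr flatten; apply/eq_in_map => s.
rewrite mem_filter mem_iota => /and3P[_ s0 _]; rewrite (IH k') //; lia.
Qed.

Lemma size_words P (w : nat) : (0 < w)%N -> size (words P w.+1 w) =
  ((q - 1) * \sum_(1 <= s < w.+1 | P s) size (words P (w - s).+1 (w - s)))%N.
Proof.
move=> w0; rewrite [words P w.+1 w]/= gtn_eqF //.
rewrite size_flatten /shape -map_comp sumnE big_map big_filter big_distrr /=.
rewrite /index_iota subSS subn0 big_seq_cond [RHS]big_seq_cond.
apply: eq_bigr => s; rewrite mem_iota => /andP[/andP[s0 sw] _].
rewrite size_allpairs -cardE cardC1 subn1 (@words_fuel P w (w - s).+1) //; lia.
Qed.

Lemma size_words_ndvd (w : nat) : (0 < w)%N ->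
  size (words (fun s => ~~ (q %| s)%N) w.+1 w) = s_bound q w.
Proof.
move=> w0; pose g w := size (words (fun s => ~~ (q %| s)%N) w.+1 w).
rewrite -[LHS]/(g w); apply: count_s_bound => //; first exact: finNzRing_gt1.
by move=> w' w'0; apply: size_words.
Qed.

End Enumeration.

(** * Reduction modulo [ell_1] and conclusion *)

Section Generation.
Variable F : finFieldType.
Local Notation q := #|F|.
Local Notation letter := (nat * F)%type.
Local Notation word := (seq letter).
Implicit Types (x y : letter) (u v z : word).

(** The predicate [P] lets one statement serve both all ACMPL's and the set [AS]. *)
Lemma acmpl_wordP (w : nat) (P : pred nat) l :
  (exists n (eps : 'I_n -> F) s,
    [/\ acmpl_index w eps s, forall i, P (s i) & l = Li eps s]) <->
  exists2 v, valid w v && all (fun x => P x.1) v & l = wLi v.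
Proof.
split=> [[n [eps [s [[eps0 s0 sE] Ps ->]]]]|].
  exists [seq (s i, eps i) | i <- enum 'I_n]; last exact: Li_wLi.
  apply/andP; split; last by apply/allP => _ /mapP[i _ ->]; apply: Ps.
  apply/andP; split.
    by apply/allP => _ /mapP[i _ ->]; rewrite /valid_letter /= s0 eps0.
  by rewrite /weight -map_comp sumnE big_map -sE big_enum.
move=> [v /andP[/andP[/allP vv /eqP vE] /allP Pv] ->].
pose x (i : 'I_(size v)) := tnth (in_tuple v) i.
have vmap : [seq ((x i).1, (x i).2) | i <- enum 'I_(size v)] = v.
  rewrite -[RHS](map_tnth_enum (in_tuple v)); apply: eq_map => i.
  by rewrite -/(x i); case: (x i).
have xv i : x i \in v by exact: mem_tnth.
exists (size v), (fun i => (x i).2), (fun i => (x i).1).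
rewrite Li_wLi vmap; split=> // [|i]; last exact: Pv.
split=> [i|i|]; [by have /andP[] := vv _ (xv i) | by have /andP[] := vv _ (xv i)|].
by rewrite -vE /weight -[in RHS]vmap -map_comp sumnE big_map big_enum.
Qed.

Lemma acmpl_word w : acmpl F w = [set wLi v | v in [set v | valid w v]].
Proof.
apply/seteqP; split=> l /=.
  move=> [n [eps [s [idx ->]]]].
  have [|v /andP[vv _] ->] := (acmpl_wordP w predT (Li eps s)).1.
    by exists n, eps, s.
  by exists v.
move=> [v vv <-]; have [|n [eps [s [idx _ ->]]]] := (acmpl_wordP w predT (wLi v)).2.
  by exists v; rewrite ?vv ?all_predT.
by exists n, eps, s.
Qed.

Definition AS_word (w : nat) v := valid w v && all (fun x => ~~ (q %| x.1)%N) v.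

Lemma ASE w : AS F w = [set wLi v | v in [set v | AS_word w v]].
Proof.
apply/seteqP; split=> l /=.
  by move=> /(acmpl_wordP w (fun s => ~~ (q %| s)%N))[v vv ->]; exists v.
move=> [v vv <-]; apply/(acmpl_wordP w (fun s => ~~ (q %| s)%N)).
by exists v.
Qed.

Variable w : nat.
Hypothesis w_gt0 : (0 < w)%N.

Let ws : seq word := words F predT w.+1 w.
Let x_ (i : 'I_(size ws)) := wLi (tnth (in_tuple ws) i).

Let mem_ws v : (v \in ws) = valid w v.
Proof. by rewrite mem_words // all_predT andbT. Qed.

Let p_ell1 : {poly F} := 'X - 'X^q.

Let ell1_poly : ell F 1 = ratfun_poly p_ell1.
Proof. by rewrite ell1 theta_poly rmorphB rmorphXn. Qed.

(* [l] is congruent to an element of the span of [AS] modulo [ell_1] times    *)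
(* the [F[theta]]-module spanned by all the ACMPL's of weight [w].            *)
Let reduces (l : laurent F) := exists m : 'I_(size ws) -> {poly F},
  lin_span (AS F w) (l - \sum_i ratfun_poly (p_ell1 * m i) *: x_ i).

Let reducesB l1 l2 : reduces l1 -> reduces l2 -> reduces (l1 - l2).
Proof.
move=> [m1 h1] [m2 h2]; exists (fun i => m1 i - m2 i).
have -> : \sum_i ratfun_poly (p_ell1 * (m1 i - m2 i)) *: x_ i =
    \sum_i ratfun_poly (p_ell1 * m1 i) *: x_ i -
    \sum_i ratfun_poly (p_ell1 * m2 i) *: x_ i.
  by rewrite -sumrB; apply: eq_bigr => i _; rewrite mulrBr rmorphB scalerBl.
rewrite opprB addrACA [- l2 + _]addrC.
by have := lin_spanB h1 h2; rewrite opprB addrACA.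
Qed.

Let reduces_AS l : lin_span (AS F w) l -> reduces l.
Proof.
move=> lS; exists (fun=> 0); rewrite big1 ?subr0 // => i _.
by rewrite mulr0 rmorph0 scale0r.
Qed.

Let reduces_coef (c : F) L : all (valid w) L ->
  reduces ((ratfunC c * ell F 1) *: \sum_(z <- L) wLi z).
Proof.
(* Each word of [L] contributes [c] at its position in [ws]; repetitions in [L] add up. *)
move=> vL; exists (fun i : 'I_(size ws) => \sum_(z <- L | index z ws == i :> nat) c%:P).
rewrite [X in lin_span _ X](_ : _ = 0); first exact: lin_span0.
apply/eqP; rewrite subr_eq0; apply/eqP.
under [RHS]eq_bigr do rewrite mulr_sumr rmorph_sum scaler_suml big_mkcond.
rewrite [RHS]exchange_big scaler_sumr big_seq [RHS]big_seq; apply: eq_bigr => z zL.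
have zi : (index z ws < size ws)%N by rewrite index_mem mem_ws (allP vL).
rewrite -big_mkcond (big_pred1 (Ordinal zi)) => [|i]; last first.
  by rewrite eq_sym.
rewrite ell1_poly ratfunC_poly -rmorphM mulrC; congr (_ *: wLi _).
by rewrite (tnth_nth [::]) /= nth_index // mem_ws (allP vL).
Qed.

Let reduces_rel e v u : valid w (u ++ (q, e) :: v) ->
  reduces (\sum_(z <- [seq u ++ z | z <- rel_lhs e v]) wLi z).
Proof.
move=> vw; have e0 : e != 0.
  by case/andP: vw; rewrite all_cat /= => /and3P[_ /andP[]].
by have [L vL ->] := wLi_rel e0 vw; apply: reduces_coef.
Qed.

(** By the relation the sum of the two values reduces, so either one does as soon as the other
    does. *)
Let reduces_q_cons e y u T : valid w (u ++ (q, e) :: y :: T) ->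
  reduces (wLi (u ++ (q, e) :: y :: T)) <->
  reduces (wLi (u ++ letter_mul (q, e) y :: T)).
Proof.
move=> /reduces_rel; rewrite /= big_cons big_seq1 => R.
by split=> /(reducesB R); rewrite ?addrK // addrC addKr.
Qed.

(** Splitting off one [(q, 1)] is the induction step for letters whose weight is a multiple of
    [q]. *)
Let valid_split k e u T : valid w (u ++ ((k.+2 * q)%N, e) :: T) ->
  valid w (u ++ (q, 1) :: ((k.+1 * q)%N, e) :: T).
Proof.
have q0 : (0 < q)%N := ltnW (finNzRing_gt1 F).
rewrite /valid /weight !all_cat !map_cat !sumn_cat /= /valid_letter /=.
by rewrite !muln_gt0 q0 oner_neq0 /= (mulSn k.+1) !addnA.
Qed.

(** A final [(q, e)] is alone on the left of the relation. For a larger multiple, the split word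
    reduces by induction, and merging [(q, 1)] back preserves this. *)
Let reduces_last k e u :
  valid w (u ++ [:: ((k.+1 * q)%N, e)]) -> reduces (wLi (u ++ [:: ((k.+1 * q)%N, e)])).
Proof.
elim: k u => [|k IH] u vw.
  rewrite mul1n in vw *; have := reduces_rel vw; by rewrite /= big_seq1.
have vw' := valid_split vw.
have := (reduces_q_cons vw').1; rewrite /letter_mul /= mul1r -mulSn; apply.
by rewrite -cat_rcons; apply: IH; rewrite cat_rcons.
Qed.

(** After splitting off [(q, 1)], the smaller multiple merges into [y] by induction, then [(q, 1)]
    merges into the result. *)
Let reduces_cons k e y u T : valid w (u ++ ((k.+1 * q)%N, e) :: y :: T) ->
  reduces (wLi (u ++ letter_mul ((k.+1 * q)%N, e) y :: T)) ->
  reduces (wLi (u ++ ((k.+1 * q)%N, e) :: y :: T)).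
Proof.
elim: k u => [|k IH] u vw.
  by rewrite !mul1n in vw *; apply: (reduces_q_cons vw).2.
have vw' := valid_split vw => R.
have := (reduces_q_cons vw').1; rewrite /letter_mul /= mul1r -mulSn; apply.
rewrite -cat_rcons; apply: IH; rewrite cat_rcons //.
have := (@reduces_q_cons 1 (letter_mul ((k.+1 * q)%N, e) y) u T).
rewrite /letter_mul /= mul1r addnA -mulSn => H; apply/H => //.
move: vw'; rewrite /valid /weight !all_cat !map_cat !sumn_cat /= !addnA.
move=> /andP[/and5P[-> -> ve vy ->] ->]; rewrite !andbT /=.
exact: (valid_letter_mul ve vy).
Qed.

(** Induction on the depth: a letter of weight divisible by [q] either is last, and the word reduces
    outright, or merges into its successor and shortens the word. *)
Lemma reduces_word v : valid w v -> reduces (wLi v).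
Proof.
have [n] := ubnP (size v); elim: n v => // n IH v; rewrite ltnS => vn vv.
have [vA|] := boolP (AS_word w v).
  by apply/reduces_AS/lin_span_sub; rewrite ASE; exists v.
rewrite /AS_word vv /= => /allPn[[s e] sv]; rewrite negbK => /dvdnP[k /= sE].
have k0 : (0 < k)%N.
  move: vv => /andP[/allP/(_ _ sv)/andP[/= s0 _] _].
  by rewrite sE in s0; case: k s0 {sE}.
case: k k0 sE => // k _ /= sE; rewrite sE in sv.
move: vv vn; case/splitPr: sv => u [|y T] vv vn; first exact: reduces_last.
apply: reduces_cons => //; apply: IH.
  by move: vn; rewrite !size_cat /= !addnS.
move: vv; rewrite /valid /weight !all_cat !map_cat !sumn_cat /= !addnA.
move=> /andP[/and4P[-> ve vy ->] ->]; rewrite !andbT /=.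
exact: (valid_letter_mul ve vy).
Qed.

Lemma lin_span_AS : lin_span (AS F w) = AL F w.
Proof.
apply: eq_lin_span => l.
  rewrite ASE => -[v /andP[vv _] <-]; apply: lin_span_sub.
  by rewrite acmpl_word; exists v.
rewrite acmpl_word => -[v /= vv <-].
have /choice[m mE] i : reduces (x_ i).
  by apply: reduces_word; rewrite -mem_ws; apply: mem_tnth.
have vi : (index v ws < size ws)%N by rewrite index_mem mem_ws.
have -> : wLi v = x_ (Ordinal vi).
  by rewrite /x_ (tnth_nth [::]) /= nth_index // mem_ws.
(* The specialisation is [theta = 0], a root of [X - X^q]. *)
apply: (@lin_span_nakayama _ _ _ _ (@ratfun_poly F) (horner_eval 0) p_ell1 _ _
  x_ (\matrix_(i, j) m i j) (@ratfun_poly_inj F)) => [|i].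
  by rewrite /= /horner_eval !hornerE expr0n eqn0Ngt (ltnW (finNzRing_gt1 F)) ?subr0 ?oppr0.
by under eq_bigr do rewrite mxE.
Qed.

Lemma dim_AL : exists2 d : nat, has_dim (AL F w) d & (d <= s_bound q w)%N.
Proof.
pose vs := map (@wLi F) (words F (fun s => ~~ (q %| s)%N) w.+1 w).
have [d dP d_le] := has_dim_seq vs; exists d; last first.
  by move: d_le; rewrite size_map size_words_ndvd.
rewrite -lin_span_AS ASE; congr (has_dim _ d): dP; congr lin_span.
apply/seteqP; split=> l /=.
  by move=> /mapP[v]; rewrite mem_words // => vv ->; exists v.
by move=> [v vv <-]; apply/map_f; rewrite mem_words.
Qed.

End Generation.

Theorem theorem1p11 (F : finFieldType) (w : nat) (hw : (0 < w)%N) :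
  lin_span (AS F w) = AL F w /\
  (exists2 d : nat, has_dim (AL F w) d & (d <= s_bound #|F| w)%N).
Proof. by split; [exact: lin_span_AS | exact: dim_AL]. Qed.
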